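(* Let $\Theta=(J_3,J_5,\alpha,\beta)$ be a Jacobi-type pencil, let $\{p_n(\lambda)\}_{n=0}^\infty$ be the associated polynomials of $\Theta$, and let $\{u_n(\lambda)\}_{n=0}^\infty$ be the shifted polynomials for $\Theta$. Let $j\in\mathbb{N}$, let $J_{3;j-1},J_{5;j-1}$ be the top-left $j\times j$ submatrices of $J_3,J_5$, and consider the matrix pencil $\Phi_j=J_{5;j-1}-\lambda J_{3;j-1}$ with characteristic polynomial $D_j(\lambda)=\det(J_{5;j-1}-\lambda J_{3;j-1})$. Then: (1) There is a constant $c_j\in\mathbb{C}$ such that for all $\lambda\in\mathbb{C}$ $$D_j(\lambda)=c_j\det\begin{pmatrix}p_j(\lambda)&u_j(\lambda)\\ p_{j+1}(\lambda)&u_{j+1}(\lambda)\end{pmatrix}.$$ (2) The eigensubspaces of the pencil $\Phi_j$ are at most two-dimensional. (3) If $\vec x',\vec x''$ are eigenvectors of the pencil $\Phi_j$ corresponding to different eigenvalues, then $$[J_{3;j-1}\vec x',\vec x'']_C=0,$$ where $[\vec a,\vec b]_C:=(\vec a,C\vec b)_{\mathbb{C}^j}$, and $C\vec y:=\overline{\vec y}$ (componentwise complex conjugation) for $\vec y\in\mathbb{C}^j$.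
   Context: $\mathbb{Z}_+$ denotes the non-negative integers and $\mathbb{N}$ the positive integers; $(\cdot,\cdot)_{\mathbb{C}^j}$ is the standard inner product of $\mathbb{C}^j$, $(\vec a,\vec b)_{\mathbb{C}^j}=\sum_i a_i\overline{b_i}$. A Jacobi-type pencil is a tuple $\Theta=(J_3,J_5,\alpha,\beta)$, where $\alpha>0$, $\beta\in\mathbb{R}$, $J_3$ is a semi-infinite real symmetric tridiagonal (Jacobi) matrix, rows and columns indexed by $\mathbb{Z}_+$, with diagonal entries $b_0,b_1,\ldots\in\mathbb{R}$ and entries $(J_3)_{k,k+1}=(J_3)_{k+1,k}=a_k>0$, and $J_5$ is a semi-infinite real symmetric five-diagonal matrix with diagonal entries $\alpha_k\in\mathbb{R}$, $(J_5)_{k,k+1}=(J_5)_{k+1,k}=\beta_k\in\mathbb{R}$, $(J_5)_{k,k+2}=(J_5)_{k+2,k}=\gamma_k>0$, $k\in\mathbb{Z}_+$. Associated polynomials of $\Theta$: the unique system $\{p_n(\lambda)\}_{n=0}^\infty$ with $p_0(\lambda)=1$, $p_1(\lambda)=\alpha\lambda+\beta$ and $(J_5-\lambda J_3)(p_0(\lambda),p_1(\lambda),\ldots)^T=0$, i.e. $$\gamma_{n-2}p_{n-2}(\lambda)+(\beta_{n-1}-\lambda a_{n-1})p_{n-1}(\lambda)+(\alpha_n-\lambda b_n)p_n(\lambda)+(\beta_n-\lambda a_n)p_{n+1}(\lambda)+\gamma_np_{n+2}(\lambda)=0,\quad n\in\mathbb{Z}_+,$$ where $p_{-2}=p_{-1}=0$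 and $\gamma_{-2}=\gamma_{-1}=a_{-1}=\beta_{-1}=0$. Shifted polynomials for $\Theta$: let $J_3',J_5'$ be obtained from $J_3,J_5$ by deleting the first row and the first column, and let $\Theta'=\left(J_3',J_5',\frac{a_0}{\gamma_0},-\frac{\beta_0}{\gamma_0}\right)$, which is again a Jacobi-type pencil. If $\{f_n\}_{n\ge0}$ are the associated polynomials of $\Theta'$, then $u_0(\lambda)=0$ and $u_k(\lambda)=f_{k-1}(\lambda)$ for $k\ge1$. The eigenvalues of the pencil $\Phi_j$ are the (complex) roots of $D_j$. For an eigenvalue $\lambda_0$, an eigenvector of $\Phi_j$ corresponding to $\lambda_0$ is a non-zero $\vec x\in\mathbb{C}^j$ with $(J_{5;j-1}-\lambda_0J_{3;j-1})\vec x=0$; the eigensubspace corresponding to $\lambda_0$ is the subspace of $\mathbb{C}^j$ consisting of all such eigenvectors together with the zero vector. *)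

(* Defs.v *)
From mathcomp Require Import all_boot all_order all_algebra.
From mathcomp Require Import reals.
From mathcomp.real_closed Require Import complex.

Set Implicit Arguments.
Unset Strict Implicit.
Unset Printing Implicit Defensive.

Import Order.TTheory GRing.Theory Num.Theory.

Local Open Scope ring_scope.
Local Open Scope complex_scope.

Section JacobiTypePencils.

Variable R : realType.

Definition infmx := nat -> nat -> R.

Definition infmx_sym (J : infmx) := forall m n, J m n = J n m.

(* Tridiagonal, with a_k = J k k.+1 > 0 and b_k = J k k. *)
Definition jacobi_mx (J : infmx) :=
  [/\ infmx_sym J,
      forall m n, (m.+1 < n)%N -> J m n = 0
    & forall k, 0 < J k k.+1].

(* Five-diagonal, with alpha_k = J k k, beta_k = J k k.+1 of arbitrary sign
   and gamma_k = J k k.+2 > 0. *)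
Definition five_diagonal_mx (J : infmx) :=
  [/\ infmx_sym J,
      forall m n, (m.+2 < n)%N -> J m n = 0
    & forall k, 0 < J k k.+2].

Record jacobi_pencil := JacobiPencil {
  J3 : infmx;
  J5 : infmx;
  jp_alpha : R;
  jp_beta : R;
  J3P : jacobi_mx J3;
  J5P : five_diagonal_mx J5;
  jp_alpha_gt0 : 0 < jp_alpha
}.

(* First row and first column deleted. *)
Definition infmx_shift (J : infmx) : infmx := fun m n => J m.+1 n.+1.

Fact jacobi_mx_shift J : jacobi_mx J -> jacobi_mx (infmx_shift J).
Proof.
case=> sJ zJ pJ; rewrite /infmx_shift; split=> [m n|m n lt_mn|k]; first exact: sJ.
  by apply: zJ; rewrite ltnS.
exact: pJ.
Qed.

Fact five_diagonal_mx_shift J :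
  five_diagonal_mx J -> five_diagonal_mx (infmx_shift J).
Proof.
case=> sJ zJ pJ; rewrite /infmx_shift; split=> [m n|m n lt_mn|k]; first exact: sJ.
  by apply: zJ; rewrite ltnS.
exact: pJ.
Qed.

Fact shift_alpha_gt0 T : 0 < J3 T 0 1 / J5 T 0 2.
Proof. by case: (J3P T) (J5P T) => _ _ p3 [_ _ p5]; rewrite divr_gt0. Qed.

(* Here a_0 = J3 T 0 1, beta_0 = J5 T 0 1 and gamma_0 = J5 T 0 2. *)
Definition jp_shift (T : jacobi_pencil) : jacobi_pencil :=
  @JacobiPencil (infmx_shift (J3 T)) (infmx_shift (J5 T))
    (J3 T 0 1 / J5 T 0 2) (- (J5 T 0 1 / J5 T 0 2))
    (jacobi_mx_shift (J3P T)) (five_diagonal_mx_shift (J5P T))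
    (shift_alpha_gt0 T).

Definition pencil_entry (T : jacobi_pencil) (m n : nat) : {poly R[i]} :=
  (J5 T m n)%:C%:P - (J3 T m n)%:C *: 'X.

(* The last clause is row n of (J5 - lambda J3)(p_0, p_1, ...)^T = 0; the
   entries of that row in columns > n + 2 vanish. *)
Definition associated_polys (T : jacobi_pencil) (p : nat -> {poly R[i]}) :=
  [/\ p 0%N = 1,
      p 1%N = (jp_alpha T)%:C *: 'X + (jp_beta T)%:C%:P
    & forall n, \sum_(m < n.+3) pencil_entry T n m * p m = 0].

Definition shifted_polys (T : jacobi_pencil) (u : nat -> {poly R[i]}) :=
  u 0%N = 0 /\ associated_polys (jp_shift T) (fun k => u k.+1).

Lemma pencil_entry_gamma T n :
  pencil_entry T n n.+2 = (J5 T n n.+2)%:C%:P /\ (J5 T n n.+2)%:C != 0.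
Proof.
case: (J3P T) (J5P T) => _ z3 _ [_ _ p5]; split.
  by rewrite /pencil_entry z3 // scale0r subr0.
by rewrite fmorph_eq0 gt_eqF.
Qed.

Lemma associated_polys_uniq T p q :
  associated_polys T p -> associated_polys T q -> p =1 q.
Proof.
move=> [p0 p1 pS] [q0 q1 qS]; elim/ltn_ind=> -[|[|n]] IHn.
- by rewrite p0 q0.
- by rewrite p1 q1.
have := etrans (pS n) (esym (qS n)).
rewrite [in LHS]big_ord_recr [in RHS]big_ord_recr /=.
have [-> nz] := pencil_entry_gamma T n.
rewrite (eq_bigr (fun m : 'I_n.+2 => pencil_entry T n m * q m)); last first.
  by move=> m _; rewrite IHn.
by move/addrI; apply: mulfI; rewrite polyC_eq0.
Qed.

Lemma associated_polys_ex T : exists p, associated_polys T p.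
Proof.
pose next s n := - ((J5 T n n.+2)%:C^-1 *:
  \sum_(m < n.+2) pencil_entry T n m * (s : seq {poly R[i]})`_m).
pose s := fix s n := if n is n'.+1 then rcons (s n') (next (s n') n') else
  [:: 1; (jp_alpha T)%:C *: 'X + (jp_beta T)%:C%:P].
have szs n : size (s n) = n.+2 by elim: n => //= n IHn; rewrite size_rcons IHn.
have stab n k m : (m < n.+2)%N -> (s (k + n)%N)`_m = (s n)`_m.
  move=> lt_mn; elim: k => //= k IHk.
  by rewrite nth_rcons szs (leq_trans lt_mn) ?IHk // !ltnS leq_addl.
have sE n m : (m < n.+2)%N -> (s m)`_m = (s n)`_m.
  rewrite ltnS leq_eqVlt => /predU1P[->|lt_mn]; first by rewrite -(stab n 1%N).
  have le_mn : (m <= n)%N by [].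
  by rewrite -(subnK le_mn) stab.
exists (fun n => (s n)`_n); split=> // n.
have [entE nz] := pencil_entry_gamma T n.
have sn : (s n.+2)`_n.+2 = next (s n) n.
  by rewrite (sE n.+1) //= nth_rcons szs ltnn eqxx.
rewrite big_ord_recr /= -/(s n) entE -[rcons _ _]/(s n.+2) sn.
under eq_bigr => m _ do rewrite (sE n) //.
by rewrite mulrN mul_polyC scalerA divff // scale1r subrr.
Qed.

(* The top-left j x j submatrix; it is written J_{j-1} when indexed by the
   last row and column kept. *)
Definition truncmx (J : infmx) (j : nat) : 'M[R[i]]_j :=
  \matrix_(m < j, n < j) (J m n)%:C.

Definition pencil_mx (T : jacobi_pencil) (j : nat) (l : R[i]) : 'M[R[i]]_j :=
  truncmx (J5 T) j - l *: truncmx (J3 T) j.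

Definition char_det (T : jacobi_pencil) (j : nat) (l : R[i]) : R[i] :=
  \det (pencil_mx T j l).

Definition pencil_eigenvalue (T : jacobi_pencil) (j : nat) (l : R[i]) :=
  char_det T j l = 0.

Definition pencil_eigenvector (T : jacobi_pencil) (j : nat) (l : R[i])
    (x : 'cV[R[i]]_j) :=
  x != 0 /\ pencil_mx T j l *m x = 0.

Definition eigensubspace (T : jacobi_pencil) (j : nat) (l : R[i]) :
    {vspace 'cV[R[i]]_j} :=
  lker (linfun (mulmx (pencil_mx T j l) : 'cV[R[i]]_j -> 'cV[R[i]]_j)).

Lemma eigensubspaceP T j l x :
  x \in eigensubspace T j l <-> x = 0 \/ pencil_eigenvector T l x.
Proof.
rewrite memv_ker lfunE /=; split=> [/eqP Ax0|[->|[_ ->]]]; last 2 first.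
- by rewrite mulmx0.
- by [].
by have [->|nz_x] := eqVneq x 0; [left | right].
Qed.

Definition cvinner (j : nat) (x y : 'cV[R[i]]_j) : R[i] :=
  \sum_(k < j) x k 0 * conjc (y k 0).

Definition cvconj (j : nat) (y : 'cV[R[i]]_j) : 'cV[R[i]]_j :=
  map_mx (@conjc R) y.

Definition Cbracket (j : nat) (x y : 'cV[R[i]]_j) : R[i] :=
  cvinner x (cvconj y).

End JacobiTypePencils.

(* Main.v *)
(* Both p and u solve the recurrence given by the rows of J5 - lambda J3, with
   initial values p_0 = 1 and u_0 = 0, u_1 = 1.  Hence part (1) is
   the bandwidth s = 2 case of a determinant identity for matrices whose
   entries vanish above the s-th superdiagonal, and c_j is, up to sign, the
   product of the gamma_k for k < j.  For (2), since gamma_k != 0, row k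
   determines x_(k+2) from the previous entries, so that a kernel vector is
   determined by its first two entries.  For (3), [x, y]_C is the bilinear form
   y^T x, and symmetry of J3 and J5 yields l1 [J3 x1, x2] = l2 [J3 x1, x2]. *)

Require Import Defs.
From mathcomp Require Import all_boot all_order all_algebra.
From mathcomp Require Import perm.
From mathcomp Require Import reals.
From mathcomp.real_closed Require Import complex.

Set Implicit Arguments.
Unset Strict Implicit.
Unset Printing Implicit Defensive.

Import Order.TTheory GRing.Theory Num.Theory.

Local Open Scope ring_scope.
Local Open Scope complex_scope.

Section CyclicShift.

Variables j s : nat.

Fact rot_ord_subproof (k : 'I_(j + s)) : ((k + j) %% (j + s) < j + s)%N.
Proof. by rewrite ltn_pmod // (leq_ltn_trans _ (ltn_ord k)). Qed.

(** The map k -> k + j mod (j + s): used as a column permutation, it brings the last s columns to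
    the front. Its sign is never computed, since it depends only on j and s. *)
Definition rot_ord (k : 'I_(j + s)) := Ordinal (rot_ord_subproof k).

Lemma rot_ord_inj : injective rot_ord.
Proof.
move=> k l /(congr1 val) /= /eqP.
by rewrite eqn_modDr !modn_small // => /eqP /val_inj.
Qed.

Definition rot_perm := perm rot_ord_inj.

Lemma rot_perm_lt (k : 'I_(j + s)) (ks : (k < s)%N) :
  rot_perm k = rshift j (Ordinal ks).
Proof.
apply: val_inj; rewrite permE /=.
by rewrite modn_small addnC // ltn_add2l.
Qed.

Lemma rot_perm_ge (k : 'I_(j + s)) (l : 'I_j) :
  (k = s + l :> nat)%N -> rot_perm k = lshift s l.
Proof.
move=> kE; apply: val_inj; rewrite permE /= kE.
by rewrite addnAC (addnC s j) modnDl modn_small // (leq_trans (ltn_ord l)) ?leq_addr.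
Qed.

End CyclicShift.

(* Let B be the first j rows of e, cut to j + s columns.  Multiply the square
   matrix (B ; 0 I_s) on the right by (E | V), where E selects the last j
   columns and V holds the solutions v.  As B V = 0 and B E is lower triangular
   with diagonal e_(k,s+k), the product is block lower triangular.  Moving V to
   the front makes (E | V) unitriangular, whence the sign. *)
Lemma det_band (F : comNzRingType) (s j : nat) (e v : nat -> nat -> F)
    (e0 : forall m n, (s + m < n)%N -> e m n = 0)
    (v0 : forall k m, (k < s)%N -> (m < k)%N -> v k m = 0)
    (v1 : forall k, (k < s)%N -> v k k = 1)
    (vS : forall k n, (k < s)%N -> \sum_(m < (s + n).+1) e n m * v k m = 0) :
  \det (\matrix_(m < j, n < j) e m n) =
  (-1) ^+ rot_perm j s * (\prod_(k < j) e k (s + k)%N) *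
  \det (\matrix_(m < s, k < s) v k (j + m)%N).
Proof.
pose B : 'M[F]_(j, j + s) := \matrix_(m, n) e m n.
pose E : 'M[F]_(j + s, j) := \matrix_(m, k) (m == s + k :> nat)%N%:R.
pose V : 'M[F]_(j + s, s) := \matrix_(m, k) v k m.
have BE_entry m k : (B *m E) m k = e m (s + k)%N.
  have sk_lt : (s + k < j + s)%N by rewrite addnC ltn_add2r.
  rewrite mxE (bigD1 (Ordinal sk_lt)) //= !mxE eqxx mulr1 big1 ?addr0 // => n ne.
  by rewrite !mxE -val_eqE /= in ne *; rewrite (negPf ne) mulr0.
have BV : B *m V = 0.
  apply/matrixP=> m k; rewrite !mxE -[RHS](vS k m) //.
  have le_mj : ((s + m).+1 <= j + s)%N by rewrite -addnS addnC leq_add2r.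
  (* The recurrence [vS] for row m stops at column s + m; the remaining columns of [B] contribute 0
     by [e0]. *)
  rewrite (big_ord_widen _ (fun n => e m n * v k n) le_mj) [RHS]big_mkcond /=.
  apply: eq_bigr => n _; rewrite !mxE ltnS; case: leqP => // lt_mn.
  by rewrite e0 ?mul0r.
have detE : \det (row_mx E V) = (-1) ^+ rot_perm j s.
  have trigV : is_trig_mx (col_perm (rot_perm j s) (row_mx E V)).
    apply/is_trig_mxP => m n lt_mn; rewrite mxE.
    have [lt_ns|le_sn] := ltnP n s.
      by rewrite (rot_perm_lt lt_ns) row_mxEr mxE v0.
    have lt_nj : (n - s < j)%N by rewrite ltn_subLR // (addnC s).
    rewrite (@rot_perm_ge _ _ n (Ordinal lt_nj)) /= ?subnKC //.
    by rewrite row_mxEl mxE /= subnKC // ltn_eqF.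
  (* The permuted matrix has unit diagonal, so its determinant is 1; a sign is its own inverse and
     can be moved across the equation. *)
  have := det_trig trigV; rewrite col_permE det_mulmx det_perm odd_permV.
  rewrite [X in _ = X]big1 => [detV|m _].
    by rewrite -[LHS](signrMK (rot_perm j s)) [X in _ * X]mulrC detV mulr1.
  rewrite -col_permE mxE; have [lt_ms|le_sm] := ltnP m s.
    by rewrite (rot_perm_lt lt_ms) row_mxEr mxE v1.
  have lt_mj : (m - s < j)%N by rewrite ltn_subLR // (addnC s).
  rewrite (@rot_perm_ge _ _ m (Ordinal lt_mj)) /= ?subnKC //.
  by rewrite row_mxEl mxE /= subnKC // eqxx.
have pick_down n (W : 'M[F]_(j + s, n)) : row_mx 0 1%:M *m W = dsubmx W.
  by rewrite -{1}[W]vsubmxK mul_row_col mul0mx add0r mul1mx.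
have detA : \det (col_mx B (row_mx 0 1%:M)) = \det (\matrix_(m < j, n < j) e m n).
  rewrite -{1}[B]hsubmxK -/(block_mx _ _ _ _) det_ublock det1 mulr1.
  by congr (\det _); apply/matrixP=> m n; rewrite !mxE.
have prodE : col_mx B (row_mx 0 1%:M) *m row_mx E V =
    block_mx (B *m E) 0 (dsubmx E) (dsubmx V).
  by rewrite mul_col_mx !mul_mx_row BV !pick_down.
have := congr1 determinant prodE.
rewrite det_mulmx detA detE det_lblock det_trig; last first.
  apply/is_trig_mxP => m n lt_mn; rewrite BE_entry e0 //.
  by rewrite ltn_add2l.
rewrite (eq_bigr _ (fun k _ => BE_entry k k)) => detM.
rewrite -[LHS](signrMK (rot_perm j s)) [X in _ * X]mulrC detM mulrA.
by congr (_ * \det _); apply/matrixP=> m k; rewrite !mxE.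
Qed.

(** Strong induction on the index k >= s: in row k - s the entries of [x] before k vanish by
    induction, the coefficients after k vanish by [e0], and the coefficient of x_k is nonzero by
    [es]. *)
Lemma band_ker_eq0 (F : fieldType) (s j : nat) (e : nat -> nat -> F)
    (e0 : forall m n, (s + m < n)%N -> e m n = 0)
    (es : forall k, e k (s + k)%N != 0) (x : 'cV[F]_j) :
  (\matrix_(m < j, n < j) e m n) *m x = 0 ->
  (forall k : 'I_j, (k < s)%N -> x k 0 = 0) -> x = 0.
Proof.
move=> ex0 xs0; suff x0 n (k : 'I_j) : k = n :> nat -> x k 0 = 0.
  by apply/matrixP=> k l; rewrite ord1 mxE (x0 k).
elim/ltn_ind: n k => n IHn k kn.
have [/xs0//|le_sk] := ltnP k s.
have lt_kj : (k - s < j)%N by rewrite (leq_ltn_trans (leq_subr _ _)).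
have := congr1 (fun y : 'cV_j => y (Ordinal lt_kj) 0) ex0.
rewrite !mxE (bigD1 k) //= big1 => [|i ne_ik].
  rewrite addr0 mxE /= -{2}(subnKC le_sk) => /eqP.
  by rewrite mulf_eq0 (negPf (es _)) => /eqP.
rewrite mxE /=; have [lt_ik|lt_ki|eq_ik] := ltngtP i k.
- by rewrite (IHn i) ?mulr0 // -kn.
- by rewrite e0 ?mul0r // subnKC.
by case/eqP: ne_ik; apply: val_inj.
Qed.

Lemma dim_band_ker (F : fieldType) (s j : nat) (e : nat -> nat -> F)
    (e0 : forall m n, (s + m < n)%N -> e m n = 0)
    (es : forall k, e k (s + k)%N != 0) :
  (\dim (lker (linfun (mulmx (\matrix_(m < j, n < j) e m n) :
     'cV[F]_j -> 'cV[F]_j))) <= s)%N.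
Proof.
set U := lker _.
(* A truncated identity matrix: [f] reads off the first s coordinates, padding with zeros if j < s.
   It is injective on [U], so dim U is at most s. *)
pose f := linfun (mulmx (\matrix_(m < s, n < j) (m == n :> nat)%:R) :
  'cV[F]_j -> 'cV[F]_s).
have Uf : (U :&: lker f = 0)%VS.
  apply/eqP; rewrite -subv0; apply/subvP=> x.
  rewrite memv_cap !memv_ker !lfunE /= memv0 => /andP[/eqP ex0 /eqP fx0].
  apply/eqP/(band_ker_eq0 e0 es ex0) => k lt_ks.
  have := congr1 (fun y : 'cV_s => y (Ordinal lt_ks) 0) fx0.
  rewrite !mxE (bigD1 k) //= big1 => [|i ne_ik].
    by rewrite addr0 mxE eqxx mul1r.
  by rewrite mxE /= eq_sym [_ == _](negPf ne_ik) mul0r.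
rewrite -(limg_ker_dim f U) Uf dimv0 add0n.
by rewrite (leq_trans (dimvS (subvf _))) // dimvf dim_matrix mulr1.
Qed.

Section Pencil.

Variables (R : realType) (T : jacobi_pencil R).

Definition pencil_entry_at (l : R[i]) (m n : nat) : R[i] :=
  (J5 T m n)%:C - l * (J3 T m n)%:C.

Lemma pencil_mxE j l : pencil_mx T j l = \matrix_(m < j, n < j) pencil_entry_at l m n.
Proof. by apply/matrixP=> m n; rewrite !mxE. Qed.

Lemma horner_pencil_entry l m n : (pencil_entry T m n).[l] = pencil_entry_at l m n.
Proof. by rewrite /pencil_entry !hornerE mulrC. Qed.

Lemma pencil_entry_band l m n : (2 + m < n)%N -> pencil_entry_at l m n = 0.
Proof.
case: (J3P T) (J5P T) => _ z3 _ [_ z5 _] lt_mn.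
by rewrite /pencil_entry_at z5 // z3 ?mulr0 ?subr0 // ltnW.
Qed.

(** [J3] is tridiagonal, so the term in [l] drops out on the second superdiagonal. *)
Lemma pencil_entry_edge l m : pencil_entry_at l m (2 + m) = (J5 T m m.+2)%:C.
Proof. by rewrite -horner_pencil_entry (pencil_entry_gamma T m).1 hornerC. Qed.

Lemma recurrence_horner (q : nat -> {poly R[i]}) l n :
  (forall n, \sum_(m < n.+3) pencil_entry T n m * q m = 0) ->
  \sum_(m < n.+3) pencil_entry_at l n m * (q m).[l] = 0.
Proof.
move=> /(_ n) /(congr1 (horner^~ l)); rewrite horner0 horner_sum => {2}<-.
by apply: eq_bigr => m _; rewrite hornerM horner_pencil_entry.
Qed.

(** As u_0 = 0, column 0 drops out, and row n + 1 becomes row n of the shifted pencil. Row 0 reads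
    gamma_0 u_2 = lambda a_0 - beta_0, which is exactly what the initial data of [jp_shift]
    encode. *)
Lemma shifted_polys_recurrence u n : shifted_polys T u ->
  \sum_(m < n.+3) pencil_entry T n m * u m = 0.
Proof.
case=> u0 [u1 u2 uS]; rewrite big_ord_recl u0 mulr0 add0r.
case: n => [|n]; last exact: uS.
rewrite !big_ord_recl big_ord0 addr0 /= u1 u2 mulr1.
have [-> _] := pencil_entry_gamma T 0.
have nz : J5 T 0 2 != 0 by case: (J5P T) => _ _ g_gt0; rewrite gt_eqF.
rewrite mulrDr -[_ *: 'X]mul_polyC mulrA -!polyCM -!rmorphM.
rewrite mulrN !(mulrCA (J5 T 0 2)) divff // !mulr1 mul_polyC.
by rewrite /pencil_entry !rmorphN addrA subrK subrr.
Qed.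

Lemma truncmx_sym (J : infmx R) j : infmx_sym J -> (truncmx J j)^T = truncmx J j.
Proof. by move=> sJ; apply/matrixP=> m n; rewrite !mxE sJ. Qed.

Lemma CbracketE j (x y : 'cV[R[i]]_j) : Cbracket x y = (y^T *m x) 0 0.
Proof.
rewrite mxE; apply: eq_bigr => k _.
by rewrite !mxE conjcK mulrC.
Qed.

Lemma eigenvectors_C_orthogonal j (l1 l2 : R[i]) (x1 x2 : 'cV[R[i]]_j) :
  l1 != l2 -> pencil_mx T j l1 *m x1 = 0 -> pencil_mx T j l2 *m x2 = 0 ->
  Cbracket (truncmx (J3 T) j *m x1) x2 = 0.
Proof.
case: (J3P T) (J5P T) => s3 _ _ [s5 _ _] ne_l.
rewrite !mulmxBl -!scalemxAl => /subr0_eq eq1 /subr0_eq eq2.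
set A3 := truncmx (J3 T) j in eq1 eq2 *; set A5 := truncmx (J5 T) j in eq1 eq2.
have symm (y : 'cV_j) A : A^T = A -> x2^T *m (A *m y) = (A *m x2)^T *m y.
  by move=> symA; rewrite trmx_mul symA mulmxA.
have : (l1 - l2) *: (x2^T *m (A3 *m x1)) = 0.
  (* The factor [l1] turns [A3] into [A5] by [eq1]; symmetry moves [A5] onto [x2], where [eq2] turns
     it into [l2] times [A3]. *)
  rewrite scalerBl scalemxAr -eq1 !symm ?truncmx_sym // eq2.
  by rewrite linearZ /= -scalemxAl subrr.
move/eqP; rewrite scaler_eq0 subr_eq0 (negPf ne_l) /= => /eqP eq0.
by rewrite CbracketE eq0 mxE.
Qed.

End Pencil.

Theorem proposition1 (R : realType) (T : jacobi_pencil R)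
    (p u : nat -> {poly R[i]})
    (hp : associated_polys T p) (hu : shifted_polys T u)
    (j : nat) (hj : (0 < j)%N) :
  [/\ exists c : R[i], forall l : R[i],
        char_det T j l =
        c * \det (block_mx (p j).[l]%:M (u j).[l]%:M
                           (p j.+1).[l]%:M (u j.+1).[l]%:M : 'M[R[i]]_(1 + 1)),
      forall l : R[i], pencil_eigenvalue T j l ->
        (\dim (eigensubspace T j l) <= 2)%N
    & forall (l1 l2 : R[i]) (x1 x2 : 'cV[R[i]]_j),
        pencil_eigenvalue T j l1 -> pencil_eigenvalue T j l2 -> l1 != l2 ->
        pencil_eigenvector T l1 x1 -> pencil_eigenvector T l2 x2 ->
        Cbracket (truncmx (J3 T) j *m x1) x2 = 0].
Proof.
have band l := @pencil_entry_band R T l.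
(* The two solutions form one family indexed by k: p for k = 0 and u for k = 1. Triangularity then
   amounts to u_0 = 0. *)
have v0 l k m : (k < 2)%N -> (m < k)%N ->
    (if k == 0%N then p m else u m).[l] = 0.
  by case: k m => [|[|//]] [|//] //= _ _; case: hu => -> _; rewrite horner0.
have v1 l k : (k < 2)%N -> (if k == 0%N then p k else u k).[l] = 1.
  case: hp hu => p0 _ _ [_ [u1 _ _]].
  by case: k => [|[|//]] _; rewrite /= ?p0 ?u1 hornerC.
have vS l k n : (k < 2)%N ->
    \sum_(m < (2 + n).+1) pencil_entry_at T l n m *
      (if k == 0%N then p m else u m).[l] = 0.
  by case: k => [|[|//]] _; apply: recurrence_horner => i;
     [case: hp | apply: shifted_polys_recurrence].
split=> [|l _|l1 l2 x1 x2 _ _ ne_l [_ ex1] [_ ex2]].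
- eexists => l; rewrite /char_det pencil_mxE.
  rewrite (det_band j (band l) (v0 l) (v1 l) (vS l)).
  (* The product must be rewritten free of [l] before the still open constant c can be unified with
     it. *)
  under eq_bigr => k _ do rewrite pencil_entry_edge.
  congr (_ * \det _).
  apply/(@matrixP _ (1 + 1) (1 + 1)) => m k; rewrite [LHS]mxE.
  by case: (split_ordP m) => m' ->; case: (split_ordP k) => k' ->;
    rewrite ?(block_mxEul, block_mxEur, block_mxEdl, block_mxEdr) !ord1 mxE /=
      ?addn0 ?addn1.
- rewrite /eigensubspace pencil_mxE.
  apply: dim_band_ker (band l) _ => k.
  by rewrite pencil_entry_edge (pencil_entry_gamma T k).2.
- exact: eigenvectors_C_orthogonal ne_l ex1 ex2.
Qed.
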